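(* Let $G$ and $H$ be finitely generated groups. Then $G$ and $H$ are polynomially full if and only if $G\times H$ is polynomially full.
   Context: For a finitely generated group $G$, $G^{fin}$ is the set of finite order elements. Fixing a word length norm $\lVert\cdot\rVert$ from a finite generating set of $G$, for $h\in G$ let $C(h)$ be its conjugacy class in $G$ and $n_{h,l}:=|\{g\in C(h):\lVert g\rVert=l\}|$; $C(h)$ has polynomial growth if there are $c\in\mathbb{R}_{>0}$ and $d\in\mathbb{N}$ with $n_{h,l}\leq c\cdot l^d$ for all $l\in\mathbb{N}=\{1,2,\dots\}$; $G^{pol}:=\{g\in G : C(g)\text{ has polynomial growth}\}$. A finitely generated group $G$ is polynomially full if $G^{fin}\subseteq G^{pol}$. *)

(* Defs.v *)
From HB Require Import structures.
From mathcomp Require Import all_boot all_algebra finmap.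
From mathcomp Require Import boolp classical_sets functions cardinality reals.

Set Implicit Arguments.
Unset Strict Implicit.
Unset Printing Implicit Defensive.

Local Open Scope classical_set_scope.
Local Open Scope group_scope.

Definition word_over (G : groupType) (S w : seq G) : bool :=
  all (fun x => (x \in S) || (x^-1 \in S)) w.

Definition spelled (G : groupType) (S : seq G) (g : G) (n : nat) : Prop :=
  exists w : seq G, [/\ word_over S w, size w = n & \prod_(x <- w) x = g].

(* Finite generating sets are given as sequences; order and repetitions are
   irrelevant. *)
Definition generates (G : groupType) (S : seq G) : Prop :=
  forall g : G, exists n, spelled S g n.

Definition finitely_generated (G : groupType) : Prop :=
  exists S : seq G, generates S.

Lemma generates_ex (G : groupType) (S : seq G) (genS : generates S) (g : G) :
  exists n, `[< spelled S g n >].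
Proof. by case: (genS g) => n gn; exists n; apply/asboolP. Qed.

Definition word_norm (G : groupType) (S : seq G) (genS : generates S)
    (g : G) : nat :=
  ex_minn (generates_ex genS g).

Definition conj_class (G : groupType) (h : G) : set G :=
  [set g | exists k : G, g = h ^ k].

Definition class_sphere (G : groupType) (S : seq G) (genS : generates S)
    (h : G) (l : nat) : set G :=
  [set g | conj_class h g /\ word_norm genS g = l].

(* [fset_set] is empty on infinite sets; [finite_class_sphere] below shows
   that this default value is never used here. *)
Definition class_count (G : groupType) (S : seq G) (genS : generates S)
    (h : G) (l : nat) : nat :=
  #|` fset_set (class_sphere genS h l)|%fset.

(* As the natural numbers start at 1, so do both [d] and [l]. *)
Definition poly_growth (R : realType) (G : groupType) (S : seq G)
    (genS : generates S) (h : G) : Prop :=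
  exists (c : R) (d : nat), [/\ (0 < c)%R, (0 < d)%N &
    forall l : nat, (0 < l)%N ->
      ((class_count genS h l)%:R <= c * l%:R ^+ d)%R].

Definition fin_part (G : groupType) : set G :=
  [set g : G | exists n : nat, (0 < n)%N /\ g ^+ n = 1].

Definition pol_part (R : realType) (G : groupType) (S : seq G)
    (genS : generates S) : set G :=
  [set g | poly_growth R genS g].

Definition polynomially_full (R : realType) (G : groupType) (S : seq G)
    (genS : generates S) : Prop :=
  @fin_part G `<=` pol_part R genS.

Lemma finite_class_sphere (G : groupType) (S : seq G) (genS : generates S)
    (h : G) (l : nat) : finite_set (class_sphere genS h l).
Proof.
pose A := S ++ [seq x^-1 | x <- S].
pose f (t : l.-tuple (seq_sub A)) : G := \prod_(x <- map val t) x.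
apply: (@sub_finite_set _ _ (f @` setT)); last exact/finite_image/finite_finset.
move=> g /= [_]; rewrite /word_norm.
case: ex_minnP => n /asboolP[w [Sw szw gE]] _ nl.
have Aw : all (mem A) w.
  apply: sub_all Sw => x /orP[xS|xS]; rewrite inE /A mem_cat ?xS //.
  by apply/orP; right; apply/mapP; exists x^-1; rewrite ?invgK.
have [s ws] : exists s : seq (seq_sub A), w = map val s.
  elim: w Aw {Sw szw gE} => [|x w IH] /=; first by exists [::].
  by case/andP=> xA /IH[s ->]; exists (SeqSub xA :: s).
have szs : size s == l by rewrite -nl -szw ws size_map.
by exists (Tuple szs); rewrite // /f /= -ws.
Qed.

Lemma finitely_generated_prod (G H : groupType) :
  finitely_generated G -> finitely_generated H ->
  finitely_generated (G * H)%type.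
Proof.
case=> S genS [T genT].
pose i (x : G) : G * H := (x, 1); pose j (y : H) : G * H := (1, y).
exists (map i S ++ map j T) => -[g h].
have [n [v [Sv _ <-]]] := genS g; have [m [w [Tw _ <-]]] := genT h.
exists (size (map i v ++ map j w)); exists (map i v ++ map j w); split=> //.
  rewrite /word_over all_cat !all_map; apply/andP; split.
    apply: sub_all Sv => x /= xS; rewrite !mem_cat.
    have -> : (i x)^-1 = i x^-1 by congr pair; exact: invg1.
    by case/orP: xS => xS; rewrite (map_f i xS) ?orbT.
  apply: sub_all Tw => x /= xT; rewrite !mem_cat.
  have -> : (j x)^-1 = j x^-1 by congr pair; exact: invg1.
  by case/orP: xT => xT; rewrite (map_f j xT) ?orbT.
rewrite big_cat /= !big_map.
have -> : \prod_(x <- v) i x = i (\prod_(x <- v) x).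
  elim: v {Sv} => [|x v IH]; rewrite ?big_nil // !big_cons IH.
  by congr pair; exact: mulg1.
have -> : \prod_(x <- w) j x = j (\prod_(x <- w) x).
  elim: w {Tw} => [|x w IH]; rewrite ?big_nil // !big_cons IH.
  by congr pair; exact: mulg1.
by congr pair; [exact: mulg1|exact: mul1g].
Qed.

(* Main.v *)
From HB Require Import structures.
Require Import Defs.
From mathcomp Require Import all_boot all_order all_algebra finmap.
From mathcomp Require Import boolp classical_sets cardinality reals.

(** Polynomial growth of a class can be tested on open balls instead of spheres:
    the ball of radius [l] is a union of [l] spheres, so passing from one to the
    other costs one degree ([poly_growthP]). In contrast to spheres, balls are
    compatible with homomorphisms, because a homomorphism between finitely
    generated groups is Lipschitz for any choice of word norms
    ([word_norm_lipschitz]). That single fact makes the arbitrary generating set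
    of [G * H] harmless and leaves only counting.

    Let [G] and [H] be polynomially full, and let [(g, h)] have finite order.
    Then [g] and [h] have finite order, and the two projections send a ball of
    the class of [(g, h)] into balls of the classes of [g] and [h] of
    proportional radius; the growth of the class of [(g, h)] is therefore
    bounded by a product of two polynomials ([ball_growth_prod]).

    Conversely, [G] embeds into [G * H] by [x |-> (x, 1)], which maps finite
    order elements to finite order elements and balls of a class injectively
    into balls of the image class, so that [G] inherits polynomial fullness
    ([polynomially_full_inj]); likewise for [H]. *)

Set Implicit Arguments.
Unset Strict Implicit.
Unset Printing Implicit Defensive.

Local Open Scope group_scope.

Lemma leq_wexp2r d m n : (m <= n -> m ^ d <= n ^ d)%N.
Proof. by case: d => // d mn; rewrite leq_exp2r. Qed.

(** * Word norms and homomorphisms *)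

Lemma word_norm_spelled (G : groupType) (S : seq G) (genS : generates S) g :
  spelled S g (word_norm genS g).
Proof. by rewrite /word_norm; case: ex_minnP => n /asboolP. Qed.

Lemma word_norm_min (G : groupType) (S : seq G) (genS : generates S) g n :
  spelled S g n -> (word_norm genS g <= n)%N.
Proof.
by move=> gn; rewrite /word_norm; case: ex_minnP => m _; apply; apply/asboolP.
Qed.

Lemma word_norm1 (G : groupType) (S : seq G) (genS : generates S) :
  word_norm genS 1 = 0%N.
Proof.
apply/eqP; rewrite -leqn0; apply: word_norm_min.
by exists [::]; split; rewrite ?big_nil.
Qed.

Lemma word_normM (G : groupType) (S : seq G) (genS : generates S) x y :
  (word_norm genS (x * y) <= word_norm genS x + word_norm genS y)%N.
Proof.
have [v [Sv szv vx]] := word_norm_spelled genS x.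
have [w [Sw szw wy]] := word_norm_spelled genS y.
apply: word_norm_min; exists (v ++ w).
split; first by rewrite /word_over all_cat; apply/andP.
  by rewrite size_cat szv szw.
by rewrite big_cat -vx -wy.
Qed.

(** A letter of a word in [S] is one of finitely many elements, so the norms of
    the images of letters have a common bound, which serves as Lipschitz
    constant. *)
Lemma word_norm_lipschitz (G H : groupType) (S : seq G) (T : seq H)
    (genS : generates S) (genT : generates T) (f : UMagmaMorphism.type G H) :
  exists K, forall x, (word_norm genT (f x) <= K * word_norm genS x)%N.
Proof.
pose A := S ++ [seq x^-1 | x <- S].
exists (\max_(x <- A) word_norm genT (f x)) => x.
have [w [Sw <- <-]] := word_norm_spelled genS x.
elim: w Sw => [_|y w IH /= /andP[yS /IH{}IH]].
  by rewrite big_nil gmulf1 word_norm1.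
rewrite big_cons gmulfM mulnS; apply: leq_trans (word_normM _ _ _) _.
apply: leq_add IH; apply: (@leq_bigmax_seq _ A xpredT (word_norm genT \o f)) => //.
rewrite /A mem_cat; case/orP: yS => [->//|yS]; apply/orP; right.
by apply/mapP; exists y^-1; rewrite ?invgK.
Qed.

(** * Growth of conjugacy classes measured on balls *)

(** Balls are represented by the duplicate-free sequences they contain, which
    avoids carrying finiteness proofs around. They are open balls: the one of
    radius [0] is empty, so a bound [c * l ^ d] is meaningful for every [l], and
    a homomorphism just multiplies radii by a constant. *)
Definition ball_growth (G : groupType) (S : seq G) (genS : generates S)
    (h : G) : Prop :=
  exists c d, forall l (s : seq G), uniq s ->
    (forall x, x \in s -> conj_class h x /\ (word_norm genS x < l)%N) ->
    (size s <= c * l ^ d)%N.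

Lemma class_count_uniq (G : groupType) (S : seq G) (genS : generates S)
    (h : G) l (s : seq G) : uniq s ->
  (forall x, x \in s -> conj_class h x /\ word_norm genS x = l) ->
  (size s <= class_count genS h l)%N.
Proof.
move=> us sP; apply: uniq_leq_size => // x /sP xP.
by rewrite in_fset_set ?inE //; exact: finite_class_sphere.
Qed.

Lemma sphere_ball_growth (R : realType) (G : groupType) (S : seq G)
    (genS : generates S) (h : G) :
  poly_growth R genS h -> ball_growth genS h.
Proof.
case=> c [d [c0 _ cP]].
(* [k] is a natural constant that also covers the sphere of radius [0], about
   which the growth hypothesis says nothing. *)
pose k := (Num.bound c + class_count genS h 0)%N.
have kP l : (class_count genS h l <= k * l.+1 ^ d)%N.
  case: l => [|l]; first by rewrite exp1n muln1 leq_addl.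
  apply: (@leq_trans (Num.bound c * l.+1 ^ d)%N); last first.
    by rewrite leq_mul ?leq_addr // leq_wexp2r // leqW.
  rewrite -(Num.Theory.ler_nat R); apply: Order.POrderTheory.le_trans (cP _ _) _ => //.
  rewrite GRing.natrM GRing.natrX Num.Theory.ler_wpM2r //.
    by rewrite Num.Theory.exprn_ge0 // Num.Theory.ler0n.
  exact/Order.POrderTheory.ltW/Num.Theory.archi_boundP/Order.POrderTheory.ltW.
exists k, d.+1; elim=> [|l IH] s us sP.
  by case: s {us} sP => // x s /(_ x (mem_head _ _))[].
rewrite -(count_predC (fun x => word_norm genS x == l) s) -!size_filter.
rewrite expnS mulnCA mulSn; apply: leq_add.
  apply: leq_trans (kP l); apply: class_count_uniq; first exact: filter_uniq.
  by move=> x; rewrite mem_filter => /andP[/eqP xl /sP[]].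
apply: (@leq_trans (k * l ^ d.+1)%N).
  apply: IH; first exact: filter_uniq.
  move=> x; rewrite mem_filter => /andP[/= xl /sP[hx]].
  by rewrite ltnS leq_eqVlt (negPf xl).
by rewrite expnS mulnCA leq_mul // leq_mul // leq_wexp2r.
Qed.

Lemma ball_sphere_growth (R : realType) (G : groupType) (S : seq G)
    (genS : generates S) (h : G) :
  ball_growth genS h -> poly_growth R genS h.
Proof.
case=> c [d cP].
(* The sphere of radius [l] lies in the open ball of radius [l.+1], and
   [l.+1 <= 2 * l] since [l > 0]. *)
exists (c * 2 ^ d).+1%:R%R, d.+1; split; rewrite ?Num.Theory.ltr0n // => l l0.
rewrite -GRing.natrX -GRing.natrM Num.Theory.ler_nat.
apply: (@leq_trans (c * l.+1 ^ d)%N).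
  apply: cP; first exact: fset_uniq.
  move=> x; rewrite in_fset_set; last exact: finite_class_sphere.
  by rewrite inE => -[hx ->].
apply: (@leq_trans (c * 2 ^ d * l ^ d)%N).
  rewrite -mulnA -expnMn leq_mul // leq_wexp2r // mul2n -addnn -addn1.
  by rewrite leq_add2l.
by rewrite leq_mul // leq_pexp2l.
Qed.

Lemma poly_growthP (R : realType) (G : groupType) (S : seq G)
    (genS : generates S) (h : G) :
  poly_growth R genS h <-> ball_growth genS h.
Proof. by split; [exact: sphere_ball_growth|exact: ball_sphere_growth]. Qed.

(** * Growth under homomorphisms *)

(** The form in which the Lipschitz property is used: a homomorphism maps balls
    of a class into proportional balls of the image class. *)
Lemma ball_image (G H : groupType) (S : seq G) (T : seq H)
    (genS : generates S) (genT : generates T) (f : UMagmaMorphism.type G H) :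
  exists K, forall h l x, conj_class h x -> (word_norm genS x < l)%N ->
    conj_class (f h) (f x) /\ (word_norm genT (f x) < K * l)%N.
Proof.
have [K KP] := word_norm_lipschitz genS genT f.
exists K.+1 => h l _ [k ->] xl; split.
  by exists (f k); rewrite gmulfJ.
apply: leq_ltn_trans (KP _) _.
by rewrite mulSn -add1n leq_add ?(leq_ltn_trans _ xl) // leq_mul // ltnW.
Qed.

(** An injective homomorphism turns distinct elements of a ball into distinct
    elements of a ball of the image class. *)
Lemma ball_growth_inj (G H : groupType) (S : seq G) (T : seq H)
    (genS : generates S) (genT : generates T) (f : UMagmaMorphism.type G H) h :
  injective f -> ball_growth genT (f h) -> ball_growth genS h.
Proof.
move=> f_inj [c [d cP]]; have [K KP] := ball_image genS genT f.
exists (c * K ^ d)%N, d => l s us sP.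
rewrite -(size_map f) -mulnA -expnMn.
apply: (cP (K * l)%N); first by rewrite map_inj_uniq.
by move=> _ /mapP[x /sP[hx xl] ->]; exact: KP.
Qed.

(** A set of pairs is contained in the product of its two projections. *)
Lemma ball_growth_prod (G H : groupType) (S : seq G) (T : seq H)
    (U : seq (G * H)%type) (genS : generates S) (genT : generates T)
    (genU : generates U) g h :
  ball_growth genS g -> ball_growth genT h -> ball_growth genU (g, h).
Proof.
move=> [c [d cP]] [c' [d' cP']].
have [K KP] := ball_image genU genS (@fst G H).
have [K' KP'] := ball_image genU genT (@snd G H).
exists (c * K ^ d * (c' * K' ^ d'))%N, (d + d')%N => l s us sP.
pose s1 := undup (map fst s); pose s2 := undup (map snd s).
have sz1 : (size s1 <= c * (K * l) ^ d)%N.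
  apply: (cP (K * l)%N); first exact: undup_uniq.
  by move=> x; rewrite mem_undup => /mapP[y /sP[gy yl] ->]; exact: KP gy yl.
have sz2 : (size s2 <= c' * (K' * l) ^ d')%N.
  apply: (cP' (K' * l)%N); first exact: undup_uniq.
  by move=> x; rewrite mem_undup => /mapP[y /sP[gy yl] ->]; exact: KP' gy yl.
rewrite expnD mulnACA -(mulnA c) -(mulnA c') -!expnMn.
apply: leq_trans (leq_mul sz1 sz2); rewrite -(size_allpairs pair s1 s2).
apply: uniq_leq_size => // -[x y] xys; apply/allpairsP; exists (x, y).
by rewrite !mem_undup (map_f fst xys) (map_f snd xys).
Qed.

(** * Polynomial fullness *)

Lemma fin_part_morph (G H : groupType) (f : UMagmaMorphism.type G H) g :
  fin_part g -> fin_part (f g).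
Proof. by case=> n [n0 gn]; exists n; rewrite -gmulfXn gn gmulf1. Qed.

Lemma polynomially_full_inj (R : realType) (G H : groupType) (S : seq G)
    (T : seq H) (genS : generates S) (genT : generates T)
    (f : UMagmaMorphism.type G H) :
  injective f -> polynomially_full R genT -> polynomially_full R genS.
Proof.
move=> f_inj fullT g /(fin_part_morph f) /fullT /poly_growthP fg.
by apply/poly_growthP; exact: ball_growth_inj fg.
Qed.

Definition inlg (G H : groupType) (x : G) : G * H := (x, 1).
Definition inrg (G H : groupType) (y : H) : G * H := (1, y).

Lemma inlgM (G H : groupType) : {morph @inlg G H : x y / x * y}.
Proof. by move=> x y; congr pair; rewrite mulg1. Qed.

Lemma inrgM (G H : groupType) : {morph @inrg G H : x y / x * y}.
Proof. by move=> x y; congr pair; rewrite mulg1. Qed.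

HB.instance Definition _ (G H : groupType) :=
  isMultiplicative.Build G (G * H)%type (@inlg G H) (@inlgM G H).
HB.instance Definition _ (G H : groupType) :=
  Multiplicative_isUMagmaMorphism.Build G (G * H)%type (@inlg G H) erefl.
HB.instance Definition _ (G H : groupType) :=
  isMultiplicative.Build H (G * H)%type (@inrg G H) (@inrgM G H).
HB.instance Definition _ (G H : groupType) :=
  Multiplicative_isUMagmaMorphism.Build H (G * H)%type (@inrg G H) erefl.

Lemma inlg_inj (G H : groupType) : injective (@inlg G H).
Proof. by move=> x y []. Qed.

Lemma inrg_inj (G H : groupType) : injective (@inrg G H).
Proof. by move=> x y []. Qed.

Theorem proposition5p6 (R : realType) (G H : groupType)
    (S : seq G) (T : seq H) (U : seq (G * H)%type)
    (genS : generates S) (genT : generates T) (genU : generates U) :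
  polynomially_full R genS /\ polynomially_full R genT <->
  polynomially_full R genU.
Proof.
split=> [[fullS fullT] [g h] fin_gh|fullU].
  have fin_g : fin_part g := fin_part_morph (@fst G H) fin_gh.
  have fin_h : fin_part h := fin_part_morph (@snd G H) fin_gh.
  apply/poly_growthP; apply: (ball_growth_prod (genS := genS) (genT := genT)).
    by apply/(poly_growthP R); exact: fullS.
  by apply/(poly_growthP R); exact: fullT.
by split; apply: polynomially_full_inj fullU; [exact: inlg_inj|exact: inrg_inj].
Qed.
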